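(* For every positive integer $n$, the number $d_n^{\ast(O)}$ of pairwise non-isomorphic color $O$-diagrams with $n$ chords is $$d_n^{\ast(O)}=\frac1n\left(n!+\sum_{i\mid n,\ i\ne n}\phi\!\left(\frac ni\right)\cdot i!\cdot\left(\frac ni\right)^{i}\right),$$ where $\phi$ is Euler's totient function.
   Context: The pattern is a circle with $2n$ points numbered $1,\dots,2n$ clockwise, whose arcs $\widehat{1;2},\widehat{3;4},\dots,\widehat{2n-1;2n}$ are black and whose arcs $\widehat{2;3},\dots,\widehat{2n;1}$ are white. A color chord diagram (on the pattern) with $n$ chords is given by a partition of $\{1,\dots,2n\}$ into $n$ pairs (a gluing), the points of each pair being joined by a chord. It is an $O$-diagram if every chord joins an odd-numbered point to an even-numbered point. Two color chord diagrams are isomorphic if one is obtained from the other by a rotation respecting the colors, i.e. by a shift $j\mapsto j+2m \pmod{2n}$ of the point numbers for some integer $m$. $d_n^{\ast(O)}$ is the number of isomorphism classes of $O$-diagrams. *)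

(* Defs.v *)
From mathcomp Require Import all_boot all_order all_algebra.

Set Implicit Arguments.
Unset Strict Implicit.
Unset Printing Implicit Defensive.

(* The points 1, ..., 2n are encoded by 'I_(2 * n): the ordinal j stands for
   the point numbered j + 1. A diagram is the set of its chords, each chord
   being the set of its two endpoints. The colours of the arcs are fixed by the
   numbering (the arc from j to j + 1 is black iff j is an odd number), so they
   are not extra data. *)

Definition point_number n (j : 'I_(2 * n)) : nat := j.+1.

Definition chord_diagram n (D : {set {set 'I_(2 * n)}}) : bool :=
  partition D [set: 'I_(2 * n)] && [forall B in D, #|B| == 2].

Definition O_diagram n (D : {set {set 'I_(2 * n)}}) : bool :=
  chord_diagram D &&
  [forall B in D, [exists x in B, [exists y in B,
     odd (point_number x) && ~~ odd (point_number y)]]].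

Lemma ltn_shift n m (j : 'I_(2 * n)) : (j + 2 * m) %% (2 * n) < 2 * n.
Proof. exact: ltn_pmod (leq_ltn_trans (leq0n j) (ltn_ord j)). Qed.

Definition shift n (m : nat) (j : 'I_(2 * n)) : 'I_(2 * n) :=
  Ordinal (ltn_shift m j).

Definition rotate n m (D : {set {set 'I_(2 * n)}}) : {set {set 'I_(2 * n)}} :=
  [set [set shift m j | j in B] | B : {set 'I_(2 * n)} in D].

(* shift m depends only on m modulo n, so m < n covers every integer m; see
   isomorphicP and isomorphic_equiv below. *)
Definition isomorphic n (D E : {set {set 'I_(2 * n)}}) : bool :=
  [exists m : 'I_n, E == rotate m D].

Definition dstarO n : nat :=
  #|equivalence_partition (@isomorphic n) [set D | O_diagram D]|.

Lemma shift_mod n m (j : 'I_(2 * n)) : shift (m %% n) j = shift m j.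
Proof. by apply: val_inj; rewrite /= muln_modr modnDmr. Qed.

Lemma shiftD n m p (j : 'I_(2 * n)) : shift p (shift m j) = shift (m + p) j.
Proof. by apply: val_inj; rewrite /= modnDml mulnDr addnA. Qed.

Lemma shift0 n (j : 'I_(2 * n)) : shift 0 j = j.
Proof. by apply: val_inj; rewrite /= muln0 addn0 modn_small. Qed.

Lemma rotate_mod n m (D : {set {set 'I_(2 * n)}}) :
  rotate (m %% n) D = rotate m D.
Proof.
by apply: eq_imset => B; apply: eq_imset => j; rewrite shift_mod.
Qed.

Lemma rotateD n m p (D : {set {set 'I_(2 * n)}}) :
  rotate p (rotate m D) = rotate (m + p) D.
Proof.
rewrite /rotate -imset_comp; apply: eq_imset => B /=.
by rewrite -imset_comp; apply: eq_imset => j /=; rewrite shiftD.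
Qed.

Lemma rotate0 n (D : {set {set 'I_(2 * n)}}) : rotate 0 D = D.
Proof.
rewrite /rotate -[RHS]imset_id; apply: eq_imset => B /=.
by rewrite -[RHS]imset_id; apply: eq_imset => j /=; rewrite shift0.
Qed.

Lemma isomorphicP n (D E : {set {set 'I_(2 * n)}}) : 0 < n ->
  reflect (exists m : nat, E = rotate m D) (isomorphic D E).
Proof.
move=> n_gt0; apply: (iffP existsP) => [[m /eqP ->]|[m ->]]; first by exists m.
by exists (Ordinal (ltn_pmod m n_gt0)); rewrite /= rotate_mod.
Qed.

Lemma isomorphic_equiv n : 0 < n -> equivalence_rel (@isomorphic n).
Proof.
move=> n_gt0.
have refl (D : {set {set 'I_(2 * n)}}) : isomorphic D D.
  by apply/isomorphicP => //; exists 0; rewrite rotate0.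
have sym (D E : {set {set 'I_(2 * n)}}) : isomorphic D E -> isomorphic E D.
  case/existsP=> m /eqP ->; apply/isomorphicP => //; exists (n - m).
  by rewrite rotateD (subnKC (ltnW (ltn_ord m))) -rotate_mod modnn rotate0.
have trans (D E F : {set {set 'I_(2 * n)}}) :
    isomorphic D E -> isomorphic E F -> isomorphic D F.
  case/existsP=> m /eqP ->; case/existsP=> p /eqP ->.
  by apply/isomorphicP => //; exists (m + p); rewrite rotateD.
move=> D E F; split=> // DE.
by apply/idP/idP; apply: trans => //; apply: sym.
Qed.

(* Main.v *)
Require Import Defs.
From mathcomp Require Import all_boot all_order all_algebra.
From mathcomp Require Import all_fingroup all_solvable.

(** An O-diagram is a permutation [s] of Z/n: the chord from the odd point
    numbered [2i+1] ends at the even point numbered [2 s(i) + 2]. Rotating the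
    diagram conjugates [s] by a power of the translation [c : i -> i + 1], so the
    isomorphism classes are the orbits of [<[c]>] acting on S_n by conjugation,
    and Burnside's lemma expresses their number as the mean of the orders of the
    centralizers of the elements of [<[c]>]. The centralizer of an element only
    depends on the subgroup it generates, and for each divisor [i] of [n] there
    are [totient (n / i)] elements generating the same subgroup as [c ^ i], whose
    centralizer is the wreath product of Z/(n/i) by S_i, of order
    [i! * (n / i) ^ i]. *)

Lemma ltn_ord_glue {d k : nat} (r : 'I_d) (q : 'I_k) : r + q * d < d * k.
Proof.
apply: (@leq_trans (d + q * d)); first by rewrite ltn_add2r.
by rewrite -mulSn mulnC leq_mul2l ltn_ord orbT.
Qed.

(** * The translation of Z/n as a permutation *)

Section Rotation.

Context {n : nat}.
Implicit Type i : 'I_n.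

Definition ord_rot : 'S_n := perm (@ordS_inj n).

Lemma ord_rotX m i : (ord_rot ^+ m)%g i = (i + m) %% n :> nat.
Proof.
elim: m => [|m IHm]; first by rewrite expg0 perm1 addn0 modn_small.
by rewrite expgSr permM permE /= IHm -addn1 modnDml addn1 addnS.
Qed.

Lemma order_ord_rot : 0 < n -> #[ord_rot]%g = n.
Proof.
move=> n_gt0; apply/eqP; rewrite eqn_dvd order_dvdn; apply/andP; split.
  apply/eqP/permP => i; apply: val_inj.
  by rewrite /= ord_rotX perm1 modnDr modn_small.
(* Evaluation at the point 0 turns [ord_rot ^+ #[ord_rot] = 1] into [#[ord_rot] %% n = 0]. *)
have := ord_rotX #[ord_rot]%g (Ordinal n_gt0).
by rewrite expg_order perm1 add0n => /esym/eqP.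
Qed.

End Rotation.

(** * The centralizer of [ord_rot ^+ d] on d * k points *)

Section Wreath.

Context {d k : nat}.
Implicit Types (sf : 'S_d * {ffun 'I_d -> 'I_k}) (x : 'I_(d * k)).

Lemma ord_dvd_gt0 x : (0 < d) && (0 < k).
Proof. by rewrite -muln_gt0 (leq_ltn_trans (leq0n x)). Qed.

Lemma ltn_ord_mod x : x %% d < d.
Proof. by case/andP: (ord_dvd_gt0 x) => d_gt0 _; rewrite ltn_mod. Qed.

Lemma ltn_ord_div x : x %/ d < k.
Proof.
by case/andP: (ord_dvd_gt0 x) => d_gt0 _; rewrite ltn_divLR // [ltnRHS]mulnC.
Qed.

(** Coordinates adapted to [ord_rot ^+ d]: its cycles are the residue classes modulo [d], each of
    length [k], and the quotient is the position along the cycle. *)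
Definition ord_residue x : 'I_d := Ordinal (ltn_ord_mod x).
Definition ord_quotient x : 'I_k := Ordinal (ltn_ord_div x).

Definition ord_glue (r : 'I_d) (q : 'I_k) : 'I_(d * k) :=
  Ordinal (ltn_ord_glue r q).

Lemma ord_residue_glue r q : ord_residue (ord_glue r q) = r.
Proof. by apply: val_inj; rewrite /= addnC modnMDl modn_small. Qed.

Lemma ord_quotient_glue r q : ord_quotient (ord_glue r q) = q.
Proof.
have d_gt0 : 0 < d by apply: leq_ltn_trans (ltn_ord r).
by apply: val_inj; rewrite /= addnC divnMDl // divn_small ?addn0.
Qed.

Lemma ord_glueK x : ord_glue (ord_residue x) (ord_quotient x) = x.
Proof. by apply: val_inj; rewrite /= addnC -divn_eq. Qed.

Lemma ltn_add_mod m (q : 'I_k) : (q + m) %% k < k.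
Proof. by rewrite ltn_mod (leq_ltn_trans (leq0n q)). Qed.

Definition ord_translate m (q : 'I_k) : 'I_k := Ordinal (ltn_add_mod m q).

Lemma ord_rotX_glue j r q :
  (ord_rot ^+ d ^+ j)%g (ord_glue r q) = ord_glue r (ord_translate j q).
Proof.
have k_gt0 : 0 < k by apply: leq_ltn_trans (ltn_ord q).
apply: val_inj; rewrite /= -expgM ord_rotX /= (mulnC d j) -addnA -mulnDl.
rewrite {1}(divn_eq (q + j) k) mulnDl -mulnA (mulnC k) addnCA modnMDl.
by rewrite modn_small // (ltn_ord_glue r (ord_translate j q)).
Qed.

Lemma ord_translate_inj m : injective (ord_translate m).
Proof.
move=> q q' /(congr1 val)/eqP /=; rewrite eqn_modDr !modn_small //.
by move/eqP/val_inj.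
Qed.

(** Action of the wreath product of Z/k by S_d: [sf.1] permutes the cycles, and [sf.2 r] is the
    translation applied while cycle [r] is carried to its image. *)
Definition wreath_fun sf x : 'I_(d * k) :=
  ord_glue (sf.1 (ord_residue x))
    (ord_translate (sf.2 (ord_residue x)) (ord_quotient x)).

Lemma wreath_fun_inj sf : injective (wreath_fun sf).
Proof.
move=> x y E; have := congr1 ord_residue E.
rewrite !ord_residue_glue => /perm_inj Er; have := congr1 ord_quotient E.
rewrite !ord_quotient_glue Er => /ord_translate_inj Eq.
by rewrite -[x]ord_glueK Er Eq ord_glueK.
Qed.

Definition wreath sf : 'S_(d * k) := perm (@wreath_fun_inj sf).

Lemma wreath_glue sf r q :
  wreath sf (ord_glue r q) = ord_glue (sf.1 r) (ord_translate (sf.2 r) q).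
Proof. by rewrite permE /wreath_fun ord_residue_glue ord_quotient_glue. Qed.

Lemma ord_translate0 (k_gt0 : 0 < k) (q : 'I_k) :
  ord_translate q (Ordinal k_gt0) = q.
Proof. by apply: val_inj; rewrite /= add0n modn_small. Qed.

(** The images of the points in position 0 already determine both components. *)
Lemma wreath_inj : 0 < k -> injective wreath.
Proof.
move=> k_gt0 [s f] [s' f'] E.
have H r : ord_glue (s r) (f r) = ord_glue (s' r) (f' r).
  have := congr1 (fun t : 'S__ => t (ord_glue r (Ordinal k_gt0))) E.
  by rewrite !wreath_glue /= !ord_translate0.
congr pair; [apply/permP | apply/ffunP] => r.
  by have := congr1 ord_residue (H r); rewrite !ord_residue_glue.
by have := congr1 ord_quotient (H r); rewrite !ord_quotient_glue.
Qed.

Lemma wreath_commute sf : commute (wreath sf) (ord_rot ^+ d)%g.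
Proof.
apply/permP => x; rewrite -[x]ord_glueK !permM -[(ord_rot ^+ d)%g]expg1.
rewrite ord_rotX_glue !wreath_glue ord_rotX_glue; congr ord_glue.
by apply: val_inj; rewrite /= !modnDml addnAC.
Qed.

(** A permutation commuting with [ord_rot ^+ d] is known on a whole cycle once it is known at one
    point; the points [z r] in position 0 serve as base points. *)
Lemma commute_wreath (s : 'S_(d * k)) :
  0 < k -> commute s (ord_rot ^+ d)%g -> exists sf, s = wreath sf.
Proof.
move=> k_gt0 sC.
have sX j x : s ((ord_rot ^+ d ^+ j)%g x) = (ord_rot ^+ d ^+ j)%g (s x).
  by rewrite -!permM (commuteX j sC).
pose z r := ord_glue r (Ordinal k_gt0).
have residueX j x : ord_residue ((ord_rot ^+ d ^+ j)%g x) = ord_residue x.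
  by rewrite -[x]ord_glueK ord_rotX_glue !ord_residue_glue.
have reach x y : ord_residue x = ord_residue y ->
    exists j, y = (ord_rot ^+ d ^+ j)%g x.
  (* Go on from [x] to the end of its cycle, which is position 0 again, then forward to the position
     of [y]. *)
  move=> Exy; exists (k - ord_quotient x + ord_quotient y).
  rewrite -[x]ord_glueK ord_rotX_glue ord_quotient_glue Exy -[LHS]ord_glueK.
  congr ord_glue; apply: val_inj.
  rewrite [RHS]/= addnA subnKC ?modnDl ?modn_small ?ltn_ord_div //.
  exact: ltnW (ltn_ord_div x).
(* If [s] sends two base points into one cycle, some power of [ord_rot ^+ d] links their images,
   hence the base points themselves, which then share their residue. *)
have resz_inj : injective (fun r => ord_residue (s (z r))).
  move=> r r' /reach [j]; rewrite -sX => /perm_inj /(congr1 ord_residue).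
  by rewrite residueX !ord_residue_glue.
exists (perm resz_inj, [ffun r => ord_quotient (s (z r))]).
apply/permP => x.
have [|j ->] := reach (z (ord_residue x)) x; first exact: ord_residue_glue.
rewrite sX ord_rotX_glue wreath_glue permE ffunE -{1}[s _]ord_glueK ord_rotX_glue.
by congr ord_glue; apply: val_inj; rewrite /= add0n modnDml addnC.
Qed.

Lemma card_cent_ord_rotX : 0 < k ->
  #|('C[(@ord_rot (d * k) ^+ d)%g])%g| = d`! * k ^ d.
Proof.
move=> k_gt0.
have -> : ('C[(@ord_rot (d * k) ^+ d)%g])%g = [set wreath sf | sf in predT].
  apply/setP => s; apply/cent1P/imsetP => [sC|[sf _ ->]].
    by have [sf ->] := commute_wreath _ k_gt0 sC; exists sf.
  exact: wreath_commute.
rewrite card_imset; last exact: wreath_inj.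
by rewrite card_prod card_ffun !card_ord -card_Sn.
Qed.

End Wreath.

Lemma card_cent_ord_rot_divisor n i : 0 < n -> i %| n ->
  #|('C[(@ord_rot n ^+ i)%g])%g| = i`! * (n %/ i) ^ i.
Proof.
move=> n_gt0 /dvdnP [k En]; move: n_gt0; rewrite {n}En mulnC.
by rewrite muln_gt0 => /andP [i_gt0 k_gt0]; rewrite mulKn // card_cent_ord_rotX.
Qed.

(** * Sums of centralizer orders over a cyclic group *)

(** A cyclic group has a single subgroup of each order, so the elements counted are exactly the
    generators of [<[x ^+ i]>]. *)
Lemma card_cycle_order {gT : finGroupType} (x : gT) i :
  i %| #[x]%g -> #|[set a in <[x]>%g | #[a]%g == #[x]%g %/ i]|
                 = totient (#[x]%g %/ i).
Proof.
move=> i_dvd; have Oxi : #[x ^+ i]%g = #[x]%g %/ i by rewrite orderXdiv.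
rewrite -Oxi totient_gen; apply: eq_card => a; rewrite !inE /generator.
apply/andP/eqP => [[ax /eqP Oa]|Ea].
  apply/eqP; rewrite (eq_subG_cyclic (cycle_cyclic x)) ?cycle_subG ?mem_cycle //.
  by rewrite -!orderE Oa.
split; last by rewrite !orderE Ea.
by rewrite -cycle_subG -Ea cycle_subG mem_cycle.
Qed.

Lemma cent1_cycle_order {gT : finGroupType} (x a b : gT) :
  a \in <[x]>%g -> b \in <[x]>%g -> #[a]%g = #[b]%g -> ('C[a] = 'C[b])%g.
Proof.
move=> ax bx /eqP Oab; rewrite -!cent_cycle.
congr ('C(_))%g; apply/eqP.
by rewrite (eq_subG_cyclic (cycle_cyclic x)) ?cycle_subG.
Qed.

Lemma sum_card_cent1_cycle {gT : finGroupType} (x : gT) :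
  \sum_(a in <[x]>%g) #|'C[a]%g| =
  \sum_(i <- divisors #[x]%g) totient (#[x]%g %/ i) * #|'C[(x ^+ i)%g]%g|.
Proof.
set n := #[x]%g; have n_gt0 : 0 < n := order_gt0 x.
(* Elements are sorted by order: for each [a] the inner sum has the single term [i = n %/ #[a]], and
   [a] has the same centralizer as [x ^+ i]. Exchanging the sums then counts the elements of each
   order. *)
transitivity (\sum_(a in <[x]>%g) \sum_(i <- divisors n | #[a]%g == n %/ i)
                #|'C[(x ^+ i)%g]%g|).
  apply: eq_bigr => a ax.
  have Oa : #[a]%g %| n by apply: order_dvdG.
  have Oa_div : n %/ #[a]%g \in divisors n.
    by rewrite -dvdn_divisors // dvdn_div.
  rewrite -big_filter.
  have -> : [seq i <- divisors n | #[a]%g == n %/ i] = [:: n %/ #[a]%g].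
    rewrite -(filter_pred1_uniq (divisors_uniq n) Oa_div).
    apply: eq_in_filter => i; rewrite -dvdn_divisors // => i_dvd /=.
    by apply/eqP/eqP => ->; rewrite divnA // mulKn.
  rewrite big_seq1; congr #|pred_of_set _|.
  apply: (@cent1_cycle_order _ x) => //; first exact: mem_cycle.
  rewrite orderXdiv; last exact: dvdn_div.
  by rewrite -/n divnA // mulKn.
rewrite (exchange_big_dep predT) //=.
rewrite big_seq [RHS]big_seq; apply: eq_bigr => i.
rewrite -dvdn_divisors // => i_dvd; rewrite sum_nat_const -card_cycle_order //.
by congr (_ * _); apply: eq_card => a; rewrite !inE.
Qed.

(** * O-diagrams as permutations, rotations as conjugations *)

Section PermutationDiagrams.

Context {n : nat}.
Implicit Types (i j : 'I_n) (s : 'S_n) (D : {set {set 'I_(2 * n)}}).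

Lemma ltn_odd_point i : 2 * i < 2 * n.
Proof. by rewrite ltn_pmul2l. Qed.

Lemma ltn_even_point i : (2 * i).+1 < 2 * n.
Proof. by have := leq_mul (leqnn 2) (ltn_ord i); rewrite mulnS add2n. Qed.

(* Parity refers to [point_number], which is one more than the ordinal. *)
Definition odd_point i : 'I_(2 * n) := Ordinal (ltn_odd_point i).
Definition even_point i : 'I_(2 * n) := Ordinal (ltn_even_point i).

Lemma odd_point_inj : injective odd_point.
Proof. by move=> i j [] /eqP; rewrite eqn_pmul2l // => /eqP/val_inj. Qed.

Lemma even_point_inj : injective even_point.
Proof. by move=> i j [] /eqP; rewrite eqn_pmul2l // => /eqP/val_inj. Qed.

Lemma odd_point_neq i j : (odd_point i == even_point j) = false.
Proof.
apply/eqP => /(congr1 (fun x : 'I__ => odd x)) /=.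
by rewrite !mul2n /= !odd_double.
Qed.

Lemma ltn_half_point (x : 'I_(2 * n)) : x./2 < n.
Proof. by rewrite ltn_half_double -mul2n. Qed.

Lemma pointP (x : 'I_(2 * n)) :
  x = (if odd (point_number x) then odd_point else even_point)
        (Ordinal (ltn_half_point x)).
Proof.
apply: val_inj; rewrite /point_number /= -[LHS]odd_double_half -mul2n.
by case: (odd x).
Qed.

Definition chord i j : {set 'I_(2 * n)} := [set odd_point i; even_point j].

Lemma odd_point_chord i i' j : (odd_point i \in chord i' j) = (i == i').
Proof. by rewrite !inE (inj_eq odd_point_inj) odd_point_neq orbF. Qed.

Lemma even_point_chord i j j' : (even_point j \in chord i j') = (j == j').
Proof. by rewrite !inE (inj_eq even_point_inj) eq_sym odd_point_neq. Qed.

Lemma chord_inj i i' j j' : chord i j = chord i' j' -> i = i' /\ j = j'.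
Proof.
move=> E; split; apply/eqP.
  by rewrite -(odd_point_chord _ _ j') -E odd_point_chord.
by rewrite -(even_point_chord i') -E even_point_chord.
Qed.

Definition diagram s : {set {set 'I_(2 * n)}} := [set chord i (s i) | i : 'I_n].

Lemma mem_diagram s i : chord i (s i) \in diagram s.
Proof. by apply/imsetP; exists i. Qed.

Lemma diagram_inj : injective diagram.
Proof.
move=> s t E; apply/permP => i.
have: chord i (s i) \in diagram t by rewrite -E mem_diagram.
by case/imsetP => j _ /chord_inj [-> ->].
Qed.

Lemma O_diagram_diagram s : O_diagram (diagram s).
Proof.
apply/andP; split; last first.
  apply/forall_inP => _ /imsetP [i _ ->].
  apply/exists_inP; exists (odd_point i); first by rewrite odd_point_chord.
  apply/exists_inP; exists (even_point (s i)); first by rewrite even_point_chord.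
  by rewrite /point_number /= !mul2n /= !odd_double.
apply/andP; split; last first.
  by apply/forall_inP => _ /imsetP [i _ ->]; rewrite cards2 odd_point_neq.
apply/and3P; split.
- rewrite eqEsubset subsetT; apply/subsetP => x _; apply/bigcupP.
  rewrite [x]pointP; set y := Ordinal _; case: ifP => _.
    by exists (chord y (s y)); rewrite ?mem_diagram ?odd_point_chord.
  exists (chord (s^-1 y)%g (s (s^-1 y)%g)); first exact: mem_diagram.
  by rewrite even_point_chord permKV.
- apply/trivIsetP => _ _ /imsetP [i _ ->] /imsetP [j _ ->] neq.
  rewrite -setI_eq0; apply/eqP/setP => x; rewrite in_setI in_set0 [x]pointP.
  apply/negP => /andP []; case: ifP => _.
    rewrite !odd_point_chord => /eqP -> /eqP Eij.
    by rewrite Eij eqxx in neq.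
  rewrite !even_point_chord => /eqP -> /eqP /perm_inj Eij.
  by rewrite Eij eqxx in neq.
apply/imsetP => -[i _ /setP /(_ (odd_point i))].
by rewrite odd_point_chord eqxx inE.
Qed.

Lemma O_diagram_chord D B : O_diagram D -> B \in D -> exists i j, B = chord i j.
Proof.
case/andP => /andP [_ /forall_inP card2] /forall_inP colored BD.
case/exists_inP: (colored B BD) => x Bx /exists_inP [y By /andP [ox oy]].
rewrite [x]pointP ox in Bx; rewrite [y]pointP (negPf oy) in By.
move: Bx By; set i := Ordinal _; set j := Ordinal _ => Bx By.
exists i, j; apply/esym/eqP.
rewrite eqEcard (eqP (card2 B BD)) cards2 odd_point_neq andbT.
by apply/subsetP => z /set2P [] ->.
Qed.

(** The chords cover every odd point, which yields a function [f] from odd to even points; their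
    disjointness makes [f] injective and leaves no further chord. *)
Lemma O_diagramP D : reflect (exists s, D = diagram s) (O_diagram D).
Proof.
apply: (iffP idP) => [OD|[s ->]]; last exact: O_diagram_diagram.
have /and3P [/eqP coverD tiD _] : partition D setT by case/andP: OD => /andP [].
have unique B B' x : B \in D -> B' \in D -> x \in B -> x \in B' -> B = B'.
  by move=> BD BD' xB xB'; rewrite -(def_pblock tiD BD xB) (def_pblock tiD BD' xB').
have /fin_all_exists [f fP] i : exists j, chord i j \in D.
  have: odd_point i \in cover D by rewrite coverD inE.
  case/bigcupP => B BD; have [i' [j EB]] := O_diagram_chord _ _ OD BD.
  by rewrite EB odd_point_chord => /eqP ->; exists j; rewrite -EB.
have f_inj : injective f.
  move=> i i' Ef; have /chord_inj[] // : chord i (f i) = chord i' (f i').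
  apply: (unique _ _ (even_point (f i))) => //; first by rewrite even_point_chord.
  by rewrite even_point_chord Ef.
exists (perm f_inj); apply/setP => B; apply/idP/imsetP => [BD|[i _ ->]]; last first.
  by rewrite permE.
have [i [j EB]] := O_diagram_chord _ _ OD BD; exists i => //; rewrite permE.
by apply: (unique _ _ (odd_point i)); rewrite // ?EB odd_point_chord.
Qed.

Lemma shift_odd_point m i :
  shift m (odd_point i) = odd_point ((ord_rot ^+ m)%g i).
Proof. by apply: val_inj; rewrite /= ord_rotX -mulnDr muln_modr. Qed.

Lemma shift_even_point m i :
  shift m (even_point i) = even_point ((ord_rot ^+ m)%g i).
Proof.
apply: val_inj; rewrite /= ord_rotX addSn -mulnDr -addn1 {1}(divn_eq (i + m) n).
(* The ordinal of an even point is 2i + 1, so the factor 2 cannot be pulled out of the modulus;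
   instead the multiple of 2n is dropped and the remainder is seen to be below 2n. *)
rewrite mulnDr mulnCA -addnA modnMDl addn1 modn_small //.
by have := ltn_even_point ((ord_rot ^+ m)%g i); rewrite ord_rotX.
Qed.

(** The chord from [i] to [s i] moves to the chord from [c i] to [c (s i)], and the conjugate of [s]
    by [c] is the permutation sending [c i] to [c (s i)]. *)
Lemma rotate_diagram m s :
  rotate m (diagram s) = diagram (s ^ (ord_rot ^+ m))%g.
Proof.
set c := (ord_rot ^+ m)%g.
have shift_chord i :
    [set shift m x | x in chord i (s i)] = chord (c i) ((s ^ c)%g (c i)).
  by rewrite imsetU1 imset_set1 shift_odd_point shift_even_point permJ.
apply/setP => B; apply/imsetP/imsetP => [[_ /imsetP [i _ ->] ->]|[i _ ->]].
  by exists (c i).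
exists (chord (c^-1 i)%g (s (c^-1 i)%g)); first exact: mem_diagram.
by rewrite shift_chord permKV.
Qed.

Lemma isomorphic_diagram s t : 0 < n ->
  isomorphic (diagram s) (diagram t) = (t \in s ^: <[ord_rot]>)%g.
Proof.
move=> n_gt0; apply/isomorphicP/imsetP => // [[m]|[_ /cycleP [m ->] ->]].
  rewrite rotate_diagram => /diagram_inj ->.
  by exists (ord_rot ^+ m)%g; rewrite ?mem_cycle.
by exists m; rewrite rotate_diagram.
Qed.

Lemma dstarO_classes : 0 < n ->
  dstarO n = #|[set (s ^: <[ord_rot]>)%g | s in [set: 'S_n]]|.
Proof.
move=> n_gt0; rewrite /dstarO /equivalence_partition.
(* Orbits are replaced by their images under [diagram], without changing their number, so that both
   sides count sets of diagrams. *)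
rewrite -(card_imset _ (imset_inj diagram_inj)) -imset_comp.
suff -> : [set D | O_diagram D] = [set diagram s | s in [set: 'S_n]].
  rewrite -imset_comp; apply: eq_card => P; congr (P \in pred_of_set _).
  apply: eq_imset => s; apply/setP => D; rewrite inE.
  apply/andP/imsetP => [[/imsetP [t _ ->]]|[t st ->]].
    by rewrite isomorphic_diagram // => st; exists t.
  by rewrite isomorphic_diagram // imset_f.
apply/setP => D; rewrite inE; apply/O_diagramP/imsetP => [[s ->]|[s _ ->]].
  by exists s; rewrite ?inE.
by exists s.
Qed.

End PermutationDiagrams.

(** * Orbit counting and the final formula *)

Lemma burnside_dstarO n : 0 < n ->
  n * dstarO n = \sum_(i <- divisors n) totient (n %/ i) * i`! * (n %/ i) ^ i.
Proof.
move=> n_gt0; have On : #[@ord_rot n]%g = n := order_ord_rot n_gt0.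
have acts : [acts <[@ord_rot n]>%g, on [set: 'S_n] | 'J].
  by apply/actsP => a _ s; rewrite !inE.
have := Frobenius_Cauchy acts; rewrite -orderE On mulnC.
rewrite (_ : #|_| = dstarO n) => [<-|]; last first.
  by rewrite dstarO_classes.
transitivity (\sum_(a in <[@ord_rot n]>%g) #|'C[a]%g|).
  (* Under conjugation the fixed points of [a] are the permutations commuting with [a]. *)
  by apply: eq_bigr => a _; rewrite setTI afixJ cent_set1.
rewrite sum_card_cent1_cycle On big_seq [RHS]big_seq; apply: eq_bigr => i.
rewrite -dvdn_divisors // => i_dvd.
by rewrite card_cent_ord_rot_divisor // mulnA.
Qed.

Local Open Scope ring_scope.

Theorem corollary5p1 (n : nat) (hn : (0 < n)%N) :
  (dstarO n)%:R =
    n%:R^-1 * (n`! + \sum_(i <- divisors n | i != n)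
                       totient (n %/ i) * i`! * (n %/ i) ^ i)%N%:R :> rat.
Proof.
have n_neq0 : n%:R != 0 :> rat by rewrite Num.Theory.pnatr_eq0 -lt0n.
apply: (GRing.mulfI n_neq0); rewrite GRing.mulVKf // -GRing.natrM.
congr (_%:R); rewrite burnside_dstarO //.
(* The divisor [i = n], contributed by the identity rotation, gives the isolated [n!], since
   [totient 1] and [1 ^ n] are both 1. *)
rewrite (bigD1_seq n) ?divisors_uniq ?divisors_id //=.
by rewrite divnn hn exp1n muln1 mul1n.
Qed.
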